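(* For all complex $\mu,\beta$ such that none of $\mu$, $\mu+1$, $\mu+\beta$, $\mu+\beta+1$ is a non-positive integer, and for all complex $x$, the following identity holds: $$ (\mu+\beta)\,{}_1F_1(1;\mu+1;x)\,{}_1F_1(1;\mu+\beta;x)-\mu\,{}_1F_1(1;\mu;x)\,{}_1F_1(1;\mu+1+\beta;x) $$ $$ =(\mu+\beta)\,{}_1F_1(1;\mu+1;x)-\mu\,{}_1F_1(1;\mu+1+\beta;x). $$
   Context: The Kummer function is ${}_1F_1(a;b;x)=\sum_{k\ge0}\frac{(a)_k}{(b)_k}\frac{x^k}{k!}$, where $(z)_k=z(z+1)\cdots(z+k-1)$, $(z)_0=1$. *)

(* Defs.v *)
From mathcomp Require Import all_boot all_order all_algebra.
From mathcomp Require Import complex.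
From mathcomp Require Import reals topology normedtype sequences.

Set Implicit Arguments.
Unset Strict Implicit.
Unset Printing Implicit Defensive.

Import Order.TTheory GRing.Theory Num.Theory.
Import numFieldNormedType.Exports.

Local Open Scope ring_scope.
Local Open Scope complex_scope.

Definition nonpos_integer (R : realType) (z : R[i]) : Prop :=
  exists n : nat, z = - n%:R.

Definition pochhammer (R : realType) (z : R[i]) (k : nat) : R[i] :=
  \prod_(0 <= j < k) (z + j%:R).

Definition hyp1F1_term (R : realType) (a b x : R[i]) (k : nat) : R[i] :=
  pochhammer a k / pochhammer b k * (x ^+ k / k`!%:R).

(* The topology is the one of the complex modulus; it is found on the regular
   algebra [R[i]^o], as [R[i]] itself carries no topological structure.
   Since inverses are total, the value is meaningful only when [b] is not a
   non-positive integer; the series then converges for every [x]. *)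
Definition hyp1F1 (R : realType) (a b x : R[i]) : R[i] :=
  limn (series (hyp1F1_term a b x : nat -> R[i]^o)).

(* Main.v *)
(* Since (1)_k = k!, the k-th term of 1F1(1; b; x) is x^k / (b)_k, whence the
   recurrence  b 1F1(1; b; x) = b + x 1F1(1; b + 1; x).  Rewriting 1F1(1; mu; x)
   and 1F1(1; mu + beta; x) with it makes the products cancel. *)
Require Import Defs.
From mathcomp Require Import all_boot all_order all_algebra.
From mathcomp Require Import complex.
From mathcomp Require Import reals topology normedtype sequences.
From mathcomp Require Import boolp classical_sets ring.

Set Implicit Arguments.
Unset Strict Implicit.
Unset Printing Implicit Defensive.

Import Order.TTheory GRing.Theory Num.Theory.
Import numFieldNormedType.Exports.

Local Open Scope ring_scope.
Local Open Scope complex_scope.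

(** The embedding of [R] into [R[i]] is isometric, so limits of [Re u] and [Im u] recombine through
    u = Re u + i Im u. *)
Lemma cvg_complex (R : realType) (u : nat -> R[i]) (a b : R) :
  (complex.Re (u n) @[n --> \oo] --> a)%classic ->
  (complex.Im (u n) @[n --> \oo] --> b)%classic ->
  ((u : nat -> R[i]^o) @ \oo --> (a +i* b : R[i]^o))%classic.
Proof.
have cvgC (v : nat -> R) (c : R) : (v @ \oo --> c ->
    (fun n => (v n)%:C : R[i]^o) @ \oo --> (c%:C : R[i]^o))%classic.
  move=> vc; apply/cvgrPdist_lt => e e0.
  (* In [R[i]], [0 < e] forces [e] to be real, so the estimate takes place in [R]. *)
  have eE : e = (complex.Re e)%:C by rewrite RRe_real// gtr0_real.
  rewrite eE ltcR in e0; move/cvgrPdist_lt: vc => /(_ _ e0).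
  apply: filterS => n; rewrite -rmorphB normc_def /= expr0n /= addr0 sqrtr_sqr.
  by rewrite {2}eE ltcR.
move=> ua ub; rewrite (complexE (a +i* b)) /=.
have -> : u = fun n => (complex.Re (u n))%:C + 'i%C * (complex.Im (u n))%:C.
  by apply: funext => n; rewrite -complexE.
apply: (@cvgD _ R[i]^o); first exact: cvgC.
exact: (@cvgZl_tmp _ R[i]^o _ _ _ _ _ _ (cvgC _ _ ub)).
Qed.

(** Real and imaginary parts are bounded by the modulus, so both real series converge absolutely by
    comparison. *)
Lemma is_cvg_series_complex_geometric (R : realType) (u : nat -> R[i]) :
  (forall n, `|u n| <= 2^-1 ^+ n) -> cvgn (series (u : nat -> R[i]^o)).
Proof.
move=> u_le.
have cvgR (s : nat -> R) : (forall n, `|s n|%:C <= `|u n|) -> cvgn (series s).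
  move=> su; apply: normed_cvg.
  apply: (@series_le_cvg _ _ (geometric 1 2^-1)) => [n|n|n|] /=.
  - exact: normr_ge0.
  - by rewrite mul1r exprn_ge0 ?invr_ge0 ?ler0n.
  - rewrite mul1r -lecR (le_trans (su n))// (le_trans (u_le n))//.
    by rewrite rmorphXn fmorphV rmorph_nat.
  - apply: is_cvg_geometric_series.
    by rewrite ger0_norm ?invf_lt1 ?ltr1n ?invr_ge0.
have /cvg_ex[a ua] : cvgn (series (fun n => complex.Re (u n))).
  by apply: cvgR => n; exact: normc_ge_Re.
have /cvg_ex[b ub] : cvgn (series (fun n => complex.Im (u n))).
  (* Im z = - Re (z i) and |i| = 1 reduce this bound to the one for [Re]. *)
  apply: cvgR => n; rewrite -[complex.Im _]opprK -ReiNIm normrN.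
  rewrite (le_trans (normc_ge_Re _))// normrM (normc_def 'i%C) /=.
  by rewrite expr0n expr1n add0r sqrtr1 mulr1.
apply/cvg_ex; exists (a +i* b); apply: cvg_complex.
- apply: cvg_trans ua; apply: near_eq_cvg; apply: nearW => n; apply: esym.
  exact: (raddf_sum (@complex.Re R : Rcomplex R -> R)).
- apply: cvg_trans ub; apply: near_eq_cvg; apply: nearW => n; apply: esym.
  exact: (raddf_sum (@complex.Im R : Rcomplex R -> R)).
Qed.

Lemma hyp1F1_term1 (R : realType) (b x : R[i]) k :
  hyp1F1_term 1 b x k = x ^+ k / pochhammer b k.
Proof.
have -> : hyp1F1_term 1 b x k = k`!%:R / pochhammer b k * (x ^+ k / k`!%:R).
  rewrite /hyp1F1_term; congr (_ / _ * _); rewrite /pochhammer.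
  elim: k => [|k IH]; first by rewrite big_geq.
  by rewrite big_nat_recr//= IH factS mulnC natrM -nat1r.
have k0 : k`!%:R != 0 :> R[i] by rewrite pnatr_eq0 -lt0n fact_gt0.
by rewrite mulrC -mulrA mulKf.
Qed.

(** Taking out the first factor gives (b)_{k+1} = b (b+1)_k. *)
Lemma hyp1F1_term1S (R : realType) (b x : R[i]) k :
  hyp1F1_term 1 b x k.+1 = x / b * hyp1F1_term 1 (b + 1) x k.
Proof.
rewrite !hyp1F1_term1 exprS mulrACA -invfM; congr (_ / _).
rewrite /pochhammer big_nat_recl//= addr0; congr (_ * _).
by apply: eq_bigr => i _; rewrite -addrA nat1r.
Qed.

(** Stated for limits, this both carries convergence from [b + 1] to [b] and relates the two
    sums. *)
Lemma cvg_hyp1F1_step (R : realType) (b x l : R[i]) :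
  (series (hyp1F1_term 1 (b + 1) x : nat -> R[i]^o) @ \oo
     --> (l : R[i]^o))%classic ->
  (series (hyp1F1_term 1 b x : nat -> R[i]^o) @ \oo
     --> (1 + x / b * l : R[i]^o))%classic.
Proof.
(* The first n+1 terms for [b] are 1 and multiples of the first n terms for [b + 1]. *)
move=> cl; rewrite -cvg_shiftS /=.
have -> : (fun n => series (hyp1F1_term 1 b x : nat -> R[i]^o) n.+1) =
    (fun n => 1 + x / b * series (hyp1F1_term 1 (b + 1) x : nat -> R[i]^o) n).
  apply: funext => n; rewrite /series /= big_nat_recl//=.
  rewrite {1}hyp1F1_term1 /pochhammer big_geq // expr0 divr1 mulr_sumr.
  by congr (_ + _); apply: eq_bigr => i _; rewrite hyp1F1_term1S.
apply: (@cvgD _ R[i]^o); first exact: cvg_cst.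
exact: (@cvgZl_tmp _ R[i]^o).
Qed.

Lemma ReDnat (R : realType) (z : R[i]) n :
  complex.Re (z + n%:R) = complex.Re z + n%:R.
Proof.
rewrite (raddfD (@complex.Re R : Rcomplex R -> R)).
by rewrite -(rmorph_nat (real_complex R)).
Qed.

(* Once [Re b >= 2 |x|] the series is dominated by the geometric one of ratio
   1/2; the recurrence then brings the convergence down from [b + N] to [b]. *)
Lemma is_cvg_hyp1F1 (R : realType) (b x : R[i]) :
  cvgn (series (hyp1F1_term 1 b x : nat -> R[i]^o)).
Proof.
have large (c : R[i]) : 2 * complex.Re `|x| <= complex.Re c ->
    cvgn (series (hyp1F1_term 1 c x : nat -> R[i]^o)).
  move=> xc; apply: is_cvg_series_complex_geometric => n.
  (* [c] stays general: each step passes to [c + 1], which preserves the lower bound on the real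
     part. *)
  elim: n c xc => [|n IH] c xc.
    by rewrite hyp1F1_term1 /pochhammer big_geq// divr1 normr1.
  rewrite hyp1F1_term1S normrM exprS ler_pM// ?IH//; last first.
    by rewrite (ReDnat c 1) (le_trans xc)// lerDl.
  have xc2 : 2 * `|x| <= `|c|.
    rewrite -[`|x|]RRe_real ?normr_real// -(rmorph_nat (real_complex R)) -rmorphM.
    by rewrite (le_trans _ (normc_ge_Re _))// lecR (le_trans xc)// ler_norm.
  (* If c = 0, then x / c is 0 by the convention on inverses; otherwise [xc2] gives |x / c| <=
     1/2. *)
  have [->|c0] := eqVneq c 0; first by rewrite invr0 mulr0 normr0 invr_ge0.
  by rewrite normf_div ler_pdivrMr ?normr_gt0// ler_pdivlMl.
have down N : forall c : R[i],
    cvgn (series (hyp1F1_term 1 (c + N%:R) x : nat -> R[i]^o)) ->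
    cvgn (series (hyp1F1_term 1 c x : nat -> R[i]^o)).
  elim: N => [|N IH] c; first by rewrite addr0.
  rewrite -nat1r addrA => /IH/cvg_ex[l cl].
  by apply/cvg_ex; exists (1 + x / c * l); exact: cvg_hyp1F1_step.
(* [y] is what Re b lacks to reach 2|x|; any natural number above |y| makes up for it. *)
pose y := 2 * complex.Re `|x| - complex.Re b.
apply: (down (Num.bound `|y|)); apply: large.
rewrite ReDnat -lerBlDl (le_trans (ler_norm _))// ltW//.
exact: archi_boundP.
Qed.

(* No condition on [b]: when [b] is a non-positive integer, 1/0 = 0 truncates
   both sides consistently. *)
Lemma hyp1F1_step (R : realType) (b x : R[i]) :
  hyp1F1 1 b x = 1 + x / b * hyp1F1 1 (b + 1) x.
Proof.
have /cvg_lim := cvg_hyp1F1_step (@is_cvg_hyp1F1 R (b + 1) x).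
by apply; exact: norm_hausdorff.
Qed.

Theorem theorem7 (R : realType) (mu beta : R[i])
  (hmu : ~ nonpos_integer mu)
  (hmu1 : ~ nonpos_integer (mu + 1))
  (hmubeta : ~ nonpos_integer (mu + beta))
  (hmubeta1 : ~ nonpos_integer (mu + beta + 1))
  (x : R[i]) :
  (mu + beta) * hyp1F1 1 (mu + 1) x * hyp1F1 1 (mu + beta) x
    - mu * hyp1F1 1 mu x * hyp1F1 1 (mu + 1 + beta) x
  = (mu + beta) * hyp1F1 1 (mu + 1) x - mu * hyp1F1 1 (mu + 1 + beta) x.
Proof.
have neq0 (c : R[i]) : ~ nonpos_integer c -> c != 0.
  by move=> hc; apply/eqP => c0; apply: hc; exists 0%N; rewrite c0 oppr0.
have mu0 := neq0 _ hmu; have mb0 := neq0 _ hmubeta.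
(* Both products now contain x 1F1(1; mu+1; x) 1F1(1; mu+beta+1; x), with opposite signs. *)
rewrite (hyp1F1_step mu) (hyp1F1_step (mu + beta)) [mu + 1 + beta]addrAC.
by field; rewrite mu0 mb0.
Qed.
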